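(* Let $r>0$ and $\alpha>0$, let $$\overline{E}(r,\alpha)=\left\{x\in(0,1]:\limsup_{n\to\infty}\frac{L_n(x)}{n^r}=\alpha\right\},\qquad L_n(x)=\max\{d_i(x):1\le i\le n\},$$ and let $s(\alpha)$ be the unique real solution $s$ of the equation $\sum_{k=1}^{\infty}\left(\frac{1}{2^{\alpha}2^{k}}\right)^{s}=1$. Then $$\dim_{\mathrm{H}}\overline{E}(r,\alpha)=\begin{cases}1, & \text{if } r<1,\\ s(\alpha), & \text{if } r=1,\\ 0, & \text{if } r>1.\end{cases}$$
   Context: $\mathbb{N}=\{1,2,3,\dots\}$; $\dim_{\mathrm{H}}$ denotes Hausdorff dimension. Every $x\in(0,1]$ has a unique expansion $x=\sum_{i=1}^{\infty}2^{-(d_1(x)+d_2(x)+\cdots+d_i(x))}$ with all $d_i(x)\in\mathbb{N}$ (the power-2-decaying Gauss-like expansion); this defines the digit functions $d_i:(0,1]\to\mathbb{N}$. Equivalently, with $T:(0,1]\to(0,1]$ given by $Tx=2^nx-1$ for $x\in(2^{-n},2^{-(n-1)}]$, $n\in\mathbb{N}$, the digit $d_i(x)$ is the unique $n\in\mathbb{N}$ with $T^{i-1}x\in(2^{-n},2^{-(n-1)}]$. *)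

(* Defs.v *)
From HB Require Import structures.
From mathcomp Require Import all_boot all_order all_algebra.
From mathcomp Require Import all_classical all_reals all_analysis.
From mathcomp Require Import ring lra.

Set Implicit Arguments.
Unset Strict Implicit.
Unset Printing Implicit Defensive.

Import Order.TTheory GRing.Theory Num.Theory.
Import numFieldNormedType.Exports.

Local Open Scope classical_set_scope.
Local Open Scope ring_scope.

Section power2_decaying.
Context {R : realType}.
Implicit Types (x : R) (n i : nat).

Definition digit1_spec x : set nat :=
  [set n | (0 < n)%N /\ 2 ^- n < x <= 2 ^- n.-1].

(* Meaningful for x in (0, 1], where it is the unique n in digit1_spec x. *)
Definition digit1 x : nat := get (digit1_spec x).

Definition decayT x : R := 2 ^+ digit1 x * x - 1.

(* Digits are indexed from 1; digit 0 is never used. By digit_expansion and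
   digit_expansion_unique below, these are the digits of the expansion. *)
Definition digit i x : nat := digit1 (iter i.-1 decayT x).

Definition max_digit n x : nat := \max_(1 <= i < n.+1) digit i x.

Definition limsup_set (r alpha : R) : set R :=
  [set x | 0 < x <= 1 /\
    limn_esup (fun n => ((max_digit n x)%:R / n%:R `^ r)%:E) = alpha%:E].

(* A series of nonnegative extended reals, so a divergent series is +oo. *)
Definition dimension_equation (alpha s : R) : Prop :=
  (\sum_(1 <= k <oo) ((1 / (2 `^ alpha * 2 ^+ k)) `^ s)%:E = 1)%E.

End power2_decaying.

Section hausdorff.
Context {R : realType}.
Implicit Types (A U : set R) (s delta : R).
Local Open Scope ereal_scope.

(* The diameter of set0 is -oo. *)
Definition diam U : \bar R :=
  ereal_sup [set `|x - y|%:E | x in U & y in U].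

(* Empty sets weigh 0 for every s, and |U|^0 = 1 for nonempty U. *)
Definition diam_pow s U : \bar R :=
  if `[< U !=set0 >] then diam U `^ s else 0.

Definition hausdorff_delta s delta A : \bar R :=
  ereal_inf [set \sum_(0 <= i <oo) diam_pow s (U i) | U in
    [set U : (set R)^nat | A `<=` \bigcup_i U i /\
                           forall i, diam (U i) <= delta%:E]].

(* hausdorff_delta s is nonincreasing in delta, so the supremum is the limit
   as delta tends to 0. *)
Definition hausdorff_measure s A : \bar R :=
  ereal_sup [set hausdorff_delta s delta A | delta in [set e | (0 < e)%R]].

Definition hausdorff_dim A : \bar R :=
  ereal_inf [set s%:E | s in [set s | (0 <= s)%R /\ hausdorff_measure s A = 0]].

End hausdorff.

Section expansion.
Context {R : realType}.
Implicit Types (x : R).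

Lemma digit1_specP x : 0 < x <= 1 -> digit1_spec x (digit1 x).
Proof.
move=> /andP[x0 x1].
have [n nx] : exists n, 2 ^- n < x.
  have /cvgrPdist_lt/(_ x x0)[n _ /(_ n (leqnn n))] : (2^-1 : R) ^+ k @[k --> \oo] --> 0.
    by apply: cvg_expr; rewrite ger0_norm ?invr_ge0//; lra.
  rewrite sub0r normrN ger0_norm ?exprn_ge0 ?invr_ge0// exprVn => ?.
  by exists n.
have ex : exists n, 2 ^- n < x by exists n.
rewrite /digit1; apply: (@getPex _ (digit1_spec x)).
exists (ex_minn ex); case: ex_minnP => m mx mmin; split.
  by case: m mx {mmin} => //; rewrite expr0 invr1 ltNge x1.
rewrite mx /=; case: m mx mmin => [|m] mx mmin /=; first by rewrite expr0 invr1.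
by rewrite leNgt; apply/negP => /mmin; rewrite ltnn.
Qed.

Lemma digit1_unique x n : digit1_spec x n -> digit1 x = n.
Proof.
suff H a b : digit1_spec x a -> digit1_spec x b -> (a <= b)%N.
  move=> xn; have xd : digit1_spec x (digit1 x).
    by apply: (@getPex _ (digit1_spec x)); exists n.
  by apply/eqP; rewrite eqn_leq !H.
move=> [a0 /andP[_ xa]] [b0 /andP[bx _]]; rewrite leqNgt; apply/negP => ba.
have := lt_le_trans bx xa; rewrite ltf_pV2 ?posrE ?exprn_gt0//.
by rewrite ltr_eXn2l ?ltr1n// -ltnS prednK// ltnNge ba.
Qed.

Lemma decayT_itv x : 0 < x <= 1 -> 0 < decayT x <= 1.
Proof.
move=> /digit1_specP[n0 /andP[nx xn]]; rewrite /decayT; move: n0 nx xn.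
case: (digit1 x) => //= n _.
have p : 0 < 2 ^+ n.+1 :> R by rewrite exprn_gt0.
rewrite -(ltr_pM2l p) mulfV ?gt_eqF// => nx xn.
rewrite subr_gt0 nx /= lerBlDr -mulr2n -(mulr_natl 1) mulr1 exprS -mulrA.
rewrite -[leRHS]mulr1 ler_pM2l//.
by rewrite mulrC -ler_pdivlMr ?exprn_gt0// div1r.
Qed.

Lemma iter_decayT_itv x i : 0 < x <= 1 -> 0 < iter i decayT x <= 1.
Proof. by move=> x01; elim: i => // i /decayT_itv. Qed.

Definition partial_expansion (d : nat -> nat) (n : nat) : R :=
  \sum_(1 <= i < n.+1) 2 ^- (\sum_(1 <= j < i.+1) d j)%N.

Definition is_expansion (d : nat -> nat) x :=
  (forall i, (0 < i)%N -> (0 < d i)%N) /\ partial_expansion d n @[n --> \oo] --> x.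

Lemma partial_expansionS d n : partial_expansion d n.+1 =
  2 ^- d 1%N * (1 + partial_expansion (d \o succn) n).
Proof.
rewrite /partial_expansion big_nat_recl// big_nat1 mulrDr mulr1; congr (_ + _).
rewrite mulr_sumr; apply: eq_big_nat => i /andP[i0 _].
by rewrite big_nat_recl// exprD invfM.
Qed.

Lemma eq_partial_expansion d d' n : (forall i, (0 < i)%N -> d i = d' i) ->
  partial_expansion d n = partial_expansion d' n.
Proof.
move=> dd'; apply: eq_big_nat => i _; congr (_ ^- _).
by apply: eq_big_nat => j /andP[/dd'].
Qed.

Lemma digit_decayT i x : (0 < i)%N -> digit i.+1 x = digit i (decayT x).
Proof. by case: i => // i _; rewrite /digit/= -iterS iterSr. Qed.

Lemma digit_expansion x : 0 < x <= 1 -> is_expansion (fun i => digit i x) x.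
Proof.
move=> x01; split=> [i _|].
  by have [] := digit1_specP (iter_decayT_itv i.-1 x01).
have H n : `|x - partial_expansion (fun i => digit i x) n| <= 2^-1 ^+ n.
  elim: n x x01 => [|n IH] x x01.
    rewrite /partial_expansion big_geq// subr0 expr0.
    by case/andP: x01 => x0 x1; rewrite ger0_norm// ltW.
  have p : 0 < 2 ^+ digit1 x :> R by rewrite exprn_gt0.
  rewrite partial_expansionS.
  rewrite (eq_partial_expansion (d' := fun i => digit i (decayT x))); last first.
    by move=> i i0 /=; rewrite digit_decayT.
  rewrite {1}(_ : x = 2 ^- digit1 x * (1 + decayT x)); last first.
    by rewrite /decayT addrC subrK mulKf// gt_eqF.
  rewrite -mulrBr opprD addrACA subrr add0r normrM exprS.
  apply: ler_pM => //; last exact/IH/decayT_itv.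
  have [d0 _] := digit1_specP x01.
  rewrite ger0_norm ?invr_ge0 ?(ltW p)// lef_pV2 ?posrE//.
  by rewrite -[leLHS]expr1 ler_weXn2l// ler1n.
apply/cvgrPdist_le => e e0.
have /cvgrPdist_le/(_ e e0) : (2^-1 : R) ^+ k @[k --> \oo] --> 0.
  by apply: cvg_expr; rewrite ger0_norm ?invr_ge0//; lra.
apply: filterS => n; rewrite sub0r normrN; apply: le_trans.
by rewrite (le_trans (H n))// ler_norm.
Qed.

Lemma partial_expansion_itv d n : (forall i, (0 < i)%N -> (0 < d i)%N) ->
  0 <= partial_expansion d n <= 1.
Proof.
elim: n d => [|n IH] d d0; first by rewrite /partial_expansion big_geq// lexx ler01.
rewrite partial_expansionS.
have /andP[P0 P1] := IH (d \o succn) (fun i _ => d0 i.+1 isT).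
have p : 0 < 2 ^- d 1%N :> R by rewrite invr_gt0 exprn_gt0.
have h : 2 ^- d 1%N <= 2^-1 :> R.
  by rewrite lef_pV2 ?posrE ?exprn_gt0// -[leLHS]expr1 ler_weXn2l ?ler1n// d0.
move: (partial_expansion _ n) (2 ^- d 1%N) P0 P1 p h => a b *; apply/andP; split; nra.
Qed.

Lemma digit_expansion_unique d x : is_expansion d x ->
  0 < x <= 1 /\ forall i, (0 < i)%N -> d i = digit i x.
Proof.
have itv d' y : is_expansion d' y -> 0 < y <= 1.
  move=> [d0 dy]; apply/andP; split.
    rewrite (@lt_le_trans _ _ (2 ^- d' 1%N))// ?invr_gt0 ?exprn_gt0//.
    apply: (cvgr_to_ge dy); near=> n.
    have n0 : (0 < n)%N by near: n; exists 1%N.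
    rewrite -(prednK n0) partial_expansionS ler_peMr ?invr_ge0 ?exprn_ge0//.
    rewrite lerDl.
    by have /andP[] := partial_expansion_itv n.-1 (fun i _ => d0 i.+1 isT).
  apply: (cvgr_to_le dy); near=> n.
  by have /andP[] := partial_expansion_itv n d0.
have shift d' y : is_expansion d' y -> is_expansion (d' \o succn) (2 ^+ d' 1%N * y - 1).
  move=> [d0 dy]; split=> [i _|]; first exact: d0.
  rewrite (_ : partial_expansion _ =
    fun n => 2 ^+ d' 1%N * partial_expansion d' n.+1 - 1); last first.
    apply/funext => n; rewrite partial_expansionS mulVKf ?expf_neq0//.
    by rewrite addrC addKr.
  by apply: cvgB; [apply: cvgMl_tmp; rewrite (cvg_shiftS (partial_expansion d'))|exact: cvg_cst].
have first d' y : is_expansion d' y -> digit1 y = d' 1%N.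
  move=> dy; apply: digit1_unique; split; first by case: dy => + _; apply.
  have /andP[a b] := itv _ _ (shift _ _ dy).
  have p : 0 < 2 ^+ d' 1%N :> R by rewrite exprn_gt0.
  have d0 : (0 < d' 1)%N by case: dy => + _; apply.
  rewrite -(ltr_pM2l p) mulfV ?gt_eqF// -subr_gt0 a /=.
  move: b; rewrite -(prednK d0) /= lerBlDr => b.
  have q : 0 < 2 ^+ (d' 1%N).-1 :> R by rewrite exprn_gt0.
  rewrite -(ler_pM2l q) mulfV ?gt_eqF//.
  by move: b; rewrite exprS -mulrA; lra.
move=> dx; split; first exact: itv dx.
case=> // i _; elim: i d x dx => [|i IH] d x dx.
  by rewrite /digit/= (first _ _ dx).
rewrite digit_decayT// /decayT (first _ _ dx).
exact: IH (shift _ _ dx).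
Unshelve. all: by end_near. Qed.

End expansion.

(* Main.v *)
(* Let F(b, t) = 2^(bt) (2^t - 1), so that the dimension equation reads
   F(alpha, s) = 1; F(b, .) is increasing.

   Upper bounds. The points whose n-th digit is at least k are covered by one
   interval for each choice of the first n - 1 digits; as
   \sum_(d >= 1) 2^(-dt) = 1 / (2^t - 1), the t-th powers of the diameters add
   up to a constant times (2^t - 1)^(-n) 2^(-kt). If infinitely many digits
   satisfy d_n >= b n with F(b, t) > 1, these sums form a convergent geometric
   series, so the t-dimensional measure vanishes. On the limsup set this applies
   with b = 0 if r < 1, with any b < alpha if r = 1, and with any b if r > 1.

   Lower bounds. Suppose alpha n^r <= b n + c and F(b, s) < 1. Then the weights
   2^(-(b + d)s), d <= M, have sum at least 1 for some M, so they code the points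
   of (0, 1] by sequences of digits at most M. Put the digit floor(alpha n^r) at a
   very sparse set of positions n and the coding digits elsewhere: the result lies
   in the limsup set. Each free position carries an additional factor 2^(-bs),
   which pays for the special digits, whose sum up to n is at most about b n.
   Hence the inverse of the coding is t-Hoelder for every t < s, and the
   t-dimensional measure is nonzero. For r = 1 take b = alpha, for r < 1 let b
   tend to 0. *)
From HB Require Import structures.
Require Import Defs.
From mathcomp Require Import all_boot all_order all_algebra.
From mathcomp Require Import all_classical all_reals all_analysis.
From mathcomp Require Import ring lra.
Set Implicit Arguments.
Unset Strict Implicit.
Unset Printing Implicit Defensive.
Import Order.TTheory GRing.Theory Num.Theory.
Import numFieldNormedType.Exports.
Local Open Scope classical_set_scope.
Local Open Scope ring_scope.

(** * Hausdorff measure *)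

(* Making every set measurable turns [mu_ext] into the outer measure obtained
   from covers by arbitrary sets. *)
Definition discrete (T : Type) := T.
HB.instance Definition _ (T : pointedType) := Pointed.on (discrete T).
HB.instance Definition _ (T : pointedType) :=
  @isMeasurable.Build default_measure_display (discrete T)
    (@discrete_measurable T) (@discrete_measurable0 T)
    (@discrete_measurableC T) (@discrete_measurableU T).

Section diameter.
Context {R : realType}.
Implicit Types (A B U : set R) (t c C y z : R).
Local Open Scope ereal_scope.

Lemma le_dist_diam U x y : U x -> U y -> `|x - y|%:E <= diam U.
Proof. by move=> Ux Uy; apply: ereal_sup_ubound; exists x => //; exists y. Qed.

Lemma diam_ge0 U : U !=set0 -> 0 <= diam U.
Proof. by move=> [x Ux]; rewrite (le_trans _ (le_dist_diam Ux Ux))// lee_fin. Qed.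

Lemma diam_pow_ge0 t U : 0 <= diam_pow t U.
Proof. by rewrite /diam_pow; case: ifP => // _; exact: poweR_ge0. Qed.

Lemma diam_pow0 t : diam_pow t (@set0 R) = 0.
Proof. by rewrite /diam_pow; case: asboolP => // -[]. Qed.

Lemma le_dist_diam_pow t U x y : (0 <= t)%R -> U x -> U y ->
  (`|x - y| `^ t)%:E <= diam_pow t U.
Proof.
move=> t0 Ux Uy; rewrite /diam_pow; case: asboolP => [U0|]; last by case; exists x.
rewrite -poweR_EFin; apply: gt0_ler_poweR => //; last exact: le_dist_diam.
  by rewrite in_itv/= lee_fin normr_ge0 leey.
by rewrite in_itv/= diam_ge0// leey.
Qed.

Lemma diam_le U c : (forall x y, U x -> U y -> `|x - y| <= c)%R -> diam U <= c%:E.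
Proof.
by move=> Uc; apply: ge_ereal_sup => _ [x Ux [y Uy <-]]; rewrite lee_fin Uc.
Qed.

Lemma diam_pow_le t U c : (0 <= t)%R ->
  (forall x y, U x -> U y -> `|x - y| <= c)%R -> diam_pow t U <= (c `^ t)%:E.
Proof.
move=> t0 Uc; rewrite /diam_pow; case: asboolP => [U0|_].
  have c0 := le_trans (diam_ge0 U0) (diam_le Uc).
  rewrite -poweR_EFin; apply: gt0_ler_poweR => //; last exact: diam_le.
    by rewrite in_itv/= diam_ge0// leey.
  by rewrite in_itv/= c0 leey.
by rewrite lee_fin powR_ge0.
Qed.

Lemma diam_pow_lipschitz t c (f : R -> R) U : (0 <= t)%R -> (0 <= c)%R ->
  (forall x y, `|f x - f y| <= c * `|x - y|)%R ->
  diam_pow t (f @` U) <= (c `^ t)%:E * diam_pow t U.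
Proof.
move=> t0 c0 fc; rewrite /diam_pow; case: asboolP => [fU0|_]; last first.
  by rewrite mule_ge0 ?lee_fin ?powR_ge0//; case: ifP => // _; exact: poweR_ge0.
have U0 : U !=set0 by case: fU0 => _ [x Ux _]; exists x.
case: asboolP => // _; rewrite -poweR_EFin -poweRM ?lee_fin ?diam_ge0//.
apply: gt0_ler_poweR => //.
- by rewrite in_itv/= diam_ge0// leey.
- by rewrite in_itv/= mule_ge0 ?lee_fin ?diam_ge0// leey.
apply: ge_ereal_sup => _ [_ [x Ux <-] [_ [y Uy <-] <-]].
rewrite (@le_trans _ _ (c * `|x - y|)%:E) ?lee_fin//.
by rewrite EFinM; apply: lee_wpmul2l; [rewrite lee_fin|exact: le_dist_diam].
Qed.

(** Hausdorff content: covers without any bound on the diameters. It stands in for the measure in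
    upper bounds, as it is countably subadditive. *)
Definition hausdorff_content t : set R -> \bar R :=
  @mu_ext _ (discrete R) R (diam_pow t).

Lemma hausdorff_content_ge0 t A : 0 <= hausdorff_content t A.
Proof. by apply: mu_ext_ge0 => U; exact: diam_pow_ge0. Qed.

Lemma le_hausdorff_content t A B : A `<=` B ->
  hausdorff_content t A <= hausdorff_content t B.
Proof. exact: (@le_mu_ext _ (discrete R) R (diam_pow t) A B). Qed.

Lemma hausdorff_content_bigcup t (F : nat -> set R) :
  hausdorff_content t (\bigcup_i F i) <= \sum_(0 <= i <oo) hausdorff_content t (F i).
Proof. by apply: mu_ext_sigma_subadditive => U; exact: diam_pow_ge0. Qed.

Lemma hausdorff_content_cover t A (F : nat -> set R) : A `<=` \bigcup_i F i ->
  hausdorff_content t A <= \sum_(0 <= i <oo) diam_pow t (F i).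
Proof. by move=> AF; apply: ereal_inf_lbound; exists F. Qed.

Lemma hausdorff_content_le_diam_pow t A : hausdorff_content t A <= diam_pow t A.
Proof.
pose F i : set R := if i is 0 then A else set0.
have AF : A `<=` \bigcup_i F i by move=> x Ax; exists 0%N.
rewrite (le_trans (hausdorff_content_cover t AF))//.
rewrite nneseries_recl//; last by move=> *; exact: diam_pow_ge0.
rewrite (@eseries0 _ _ 1 predT) ?adde0//.
by case=> // i _ _ /=; rewrite diam_pow0.
Qed.

Lemma hausdorff_content_lipschitz t c (f : R -> R) A : (0 <= t)%R -> (0 < c)%R ->
  (forall x y, `|f x - f y| <= c * `|x - y|)%R ->
  hausdorff_content t (f @` A) <= (c `^ t)%:E * hausdorff_content t A.
Proof.
move=> t0 c0 fc; rewrite -lee_pdivrMl ?powR_gt0//.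
apply: le_ereal_inf_tmp => _ [U [_ AU] <-]; rewrite lee_pdivrMl ?powR_gt0//.
have fAU : f @` A `<=` \bigcup_i f @` U i.
  by move=> _ [x /AU[i _ Ui] <-]; exists i => //; exists x.
rewrite (le_trans (hausdorff_content_cover t fAU))//.
rewrite -nneseriesZl; last by move=> *; exact: diam_pow_ge0.
apply: lee_nneseries => i _; first by move=> _; exact: diam_pow_ge0.
by apply: diam_pow_lipschitz => //; exact: ltW.
Qed.

(** For t > 0, a cover whose sum is below d^t consists of sets of diameter at most d, so cheap
    covers are automatically fine. *)
Lemma hausdorff_measure_eq0 t A : (0 < t)%R ->
  hausdorff_content t A = 0 -> hausdorff_measure t A = 0.
Proof.
move=> t0 A0; apply/eqP; rewrite eq_le; apply/andP; split.
  apply: ge_ereal_sup => _ [d /= d0 <-]; apply/lee_addgt0Pr => e e0; rewrite add0e.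
  pose e' := Num.min e (d `^ t)%R.
  have e'0 : (0 < e')%R by rewrite lt_min e0 powR_gt0.
  have : hausdorff_content t A < e'%:E by rewrite A0 lte_fin.
  move=> /ereal_inf_lt[_ [U [_ AU] <-]] Ue'.
  have Ue : \sum_(0 <= i <oo) diam_pow t (U i) <= e%:E.
    by rewrite (le_trans (ltW Ue'))// lee_fin ge_min lexx.
  rewrite (le_trans _ Ue)//; apply: ereal_inf_lbound; exists U => //; split=> // i.
  rewrite leNgt; apply/negP => dU.
  have Ui0 : U i !=set0.
    apply/set0P/negP => /eqP Ui0; move: dU; rewrite Ui0 /diam.
    rewrite (_ : [set _ | _ in _ & _ in _] = set0) ?ereal_sup0 ?ltNge ?leNye//.
    by apply/seteqP; split => // ? [? []].
  have : (d `^ t)%:E <= diam_pow t (U i).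
    rewrite /diam_pow asboolT// -poweR_EFin; apply: gt0_ler_poweR => //.
    - exact: ltW.
    - by rewrite in_itv/= leey lee_fin ltW.
    - by rewrite in_itv/= leey diam_ge0.
    - exact: ltW.
  have : diam_pow t (U i) <= \sum_(0 <= i <oo) diam_pow t (U i).
    rewrite (le_trans _ (nneseries_lim_ge i.+1 _))//; last by move=> *; exact: diam_pow_ge0.
    rewrite big_nat_recr//= leeDr// sume_ge0// => *; exact: diam_pow_ge0.
  move=> a b; have := le_lt_trans (le_trans b a) Ue'.
  by rewrite lte_fin lt_min ltxx andbF.
apply: (@le_trans _ _ (hausdorff_delta t 1 A)); last first.
  by apply: ereal_sup_ubound; exists 1%R => //=.
apply: le_ereal_inf_tmp => _ [U _ <-].
by apply: nneseries_ge0 => *; exact: diam_pow_ge0.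
Qed.

(* If [g] inverts a [t]-Hoelder map of its range onto (0, 1], a cover of the
   range pulls back to a cover of (0, 1], to which Lebesgue measure applies. *)
Lemma hausdorff_measure_neq0 t C A (g : R -> R) : (0 <= t)%R -> (0 <= C)%R ->
  (forall y, 0 < y <= 1 -> A (g y))%R ->
  (forall y z, 0 < y <= 1 -> 0 < z <= 1 -> `|y - z| <= C * `|g y - g z| `^ t)%R ->
  hausdorff_measure t A <> 0.
Proof.
move=> t0 C0 Ag gC A0.
have : hausdorff_delta t 1 A <= 0.
  by rewrite -A0; apply: ereal_sup_ubound; exists 1%R => //=.
rewrite leNgt => /negP; apply.
(* The intervals [I i] have length 2 C |U i|^t; adding 1 to C keeps [c] positive when C = 0. *)
pose c := (2 * (C + 1))%R; have c0 : (0 < c)%R by rewrite /c; lra.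
apply: (@lt_le_trans _ _ c^-1%:E); first by rewrite lte_fin invr_gt0.
apply: le_ereal_inf_tmp => _ [U [AU U1] <-].
(* The preimage [V i] of [U i] under [g] may fail to be measurable, so it is enclosed in an interval
   [I i] centred at one of its points. *)
pose V i : set R := [set y | (0 < y <= 1)%R /\ U i (g y)].
pose I i : set R := if pselect (V i !=set0) is left w then
  let a := projT1 (cid w) in let l := (C * fine (diam_pow t (U i)))%R in
  `[(a - l)%R, (a + l)%R]%classic else set0.
have Ufin i : diam_pow t (U i) \is a fin_num.
  rewrite ge0_fin_numE ?diam_pow_ge0// (@le_lt_trans _ _ (1 `^ t)%:E) ?ltry//.
  apply: diam_pow_le => // x y Ux Uy.
  by rewrite -lee_fin (le_trans (le_dist_diam Ux Uy)).
have VI i : V i `<=` I i.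
  move=> y Vy; rewrite /I; case: pselect => [w|]; last by case; exists y.
  case: (cid w) => z [z01 Uz] /=; case: Vy => y01 Uy.
  rewrite in_itv/= -ler_distlC.
  apply: (le_trans (gC z y z01 y01)); apply: ler_wpM2l => //.
  by rewrite -lee_fin fineK//; exact: le_dist_diam_pow.
have cov : `]0%R, 1%R]%classic `<=` \bigcup_i I i.
  move=> y; rewrite /= in_itv/= => y01; have [i _ Ui] := AU _ (Ag _ y01).
  by exists i => //; apply: VI.
have mI i : measurable (I i).
  by rewrite /I; case: pselect => // w; exact: measurable_itv.
have : lebesgue_measure (`]0%R, 1%R] : set R) <= \sum_(0 <= i <oo) lebesgue_measure (I i).
  by apply: measure_sigma_subadditive => //; exact: measurable_itv.
rewrite lebesgue_measure_itv/= lte_fin ltr01 sube0 => le1.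
have : 1 <= \sum_(0 <= i <oo) (c%:E * diam_pow t (U i)).
  apply: (le_trans le1); apply: lee_nneseries => // i _.
  rewrite /I; case: pselect => [w|_]; last first.
    by rewrite measure0 mule_ge0 ?diam_pow_ge0// lee_fin ltW.
  set a := projT1 _; set l := (C * _)%R.
  have l0 : (0 <= l)%R by rewrite mulr_ge0// fine_ge0// diam_pow_ge0.
  rewrite lebesgue_measure_itv/=; case: ifP => _; last first.
    by rewrite mule_ge0 ?diam_pow_ge0// lee_fin ltW.
  rewrite -(fineK (Ufin i)) -EFinB -EFinM lee_fin /l /c.
  have : (0 <= fine (diam_pow t (U i)))%R by rewrite fine_ge0// diam_pow_ge0.
  lra.
rewrite nneseriesZl; last by move=> *; exact: diam_pow_ge0.
by rewrite -lee_pdivrMl// mule1.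
Qed.

End diameter.

(** * The dimension equation *)

Section dimension_function.
Context {R : realType}.
Implicit Types (a b q s t x : R).

(** For t > 0 this is the inverse of the sum of the series in the dimension equation. *)
Definition dimension_function b t : R := 2 `^ (b * t) * (2 `^ t - 1).

Lemma eseries_geometric a q : 0 <= q < 1 ->
  (\sum_(0 <= k <oo) (a * q ^+ k)%:E = (a / (1 - q))%:E)%E.
Proof.
move=> /andP[q0 q1]; apply/cvg_lim => //.
rewrite (_ : (fun n => _) = EFin \o series (geometric a q)).
  by apply: cvg_EFin; [exact: nearW|apply: cvg_geometric_series; rewrite ger0_norm].
by apply/funext => n /=; rewrite sumEFin.
Qed.

Lemma powR2E x : 2 `^ x = expR (x * ln 2) :> R.
Proof. by rewrite /powR pnatr_eq0. Qed.

Lemma powR2D s t : 2 `^ (s + t) = 2 `^ s * 2 `^ t :> R.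
Proof. by rewrite powRD// pnatr_eq0 implybT. Qed.

Lemma powR2_gt0 x : 0 < 2 `^ x :> R.
Proof. by rewrite powR_gt0. Qed.

Lemma ltr_powR2 : {mono powR (2 : R) : s t / s < t}.
Proof. by move=> s t; rewrite !powR2E ltr_expR ltr_pM2r// ln_gt0// ltr1n. Qed.

Lemma ler_powR2 : {mono powR (2 : R) : s t / s <= t}.
Proof. by move=> s t; rewrite !powR2E ler_expR ler_pM2r// ln_gt0// ltr1n. Qed.

Lemma gt1_powR2 t : 0 < t -> 1 < 2 `^ t :> R.
Proof. by move=> t0; rewrite -[ltLHS](powRr0 2) ltr_powR2. Qed.

Lemma powR2N_lt1 t : 0 < t -> 2 `^ (- t) < 1 :> R.
Proof. by move=> t0; rewrite -[ltRHS](powRr0 2) ltr_powR2 oppr_lt0. Qed.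

Lemma powR2_exprn k t : (2 ^- k : R) `^ t = (2 `^ (- t)) ^+ k.
Proof.
rewrite -(powR_mulrn _ (ler0n _ 2)) -powRN -powRrM -powR_mulrn ?powR_ge0// -powRrM.
by congr (_ `^ _); ring.
Qed.

Lemma continuous_powR2 : continuous (powR (2 : R)).
Proof.
move=> x; rewrite (_ : powR 2 = fun y : R => expR (y * ln 2)); last first.
  by apply/funext => y; rewrite powR2E.
by apply: continuous_comp; [exact: mulrr_continuous|exact: continuous_expR].
Qed.

Lemma dimension_function_mono b s t : 0 <= b -> 0 <= s -> s < t ->
  dimension_function b s < dimension_function b t.
Proof.
move=> b0 s0 st; have := st; rewrite -ltr_powR2 => st2.
apply: (@le_lt_trans _ _ (2 `^ (b * t) * (2 `^ s - 1))).
  apply: ler_wpM2r; last by rewrite ler_powR2 ler_wpM2l// ltW.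
  by rewrite subr_ge0 -[leLHS](powRr0 2) ler_powR2.
by rewrite ltr_pM2l ?powR2_gt0// ltrD2r.
Qed.

Lemma eseries_powR2 a s : 0 <= a -> 0 < s ->
  (\sum_(1 <= k <oo) (a * (2 `^ (- s)) ^+ k)%:E = (a / (2 `^ s - 1))%:E)%E.
Proof.
move=> a0 s0; have := gt1_powR2 s0; have := powR2N_lt1 s0 => q1 s1.
rewrite -(nneseries_addn 1); last first.
  by move=> i; rewrite lee_fin mulr_ge0// exprn_ge0// powR_ge0.
under eq_eseriesr do rewrite addn1 exprS mulrA.
rewrite eseries_geometric ?powR_ge0//; congr EFin.
rewrite powRN; field.
by apply/andP; split; lra.
Qed.

Lemma dimension_equation_term a s k :
  (1 / (2 `^ a * 2 ^+ k)) `^ s = 2 `^ (- (a * s)) * (2 `^ (- s)) ^+ k :> R.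
Proof.
rewrite div1r invfM powRM ?invr_ge0 ?powR_ge0 ?exprn_ge0// -powR2_exprn.
by rewrite -powRN -powRrM mulNr.
Qed.

Lemma dimension_equationE a s : 0 < s ->
  dimension_equation a s <-> dimension_function a s = 1.
Proof.
move=> s0; rewrite /dimension_equation.
under eq_eseriesr do rewrite dimension_equation_term.
rewrite eseries_powR2 ?powR_ge0// /dimension_function powRN -invfM.
have p : 0 < 2 `^ (a * s) * (2 `^ s - 1) :> R.
  by rewrite mulr_gt0 ?powR2_gt0// subr_gt0 gt1_powR2.
split=> [[/(congr1 GRing.inv)]|->]; last by rewrite invr1.
by rewrite invrK invr1.
Qed.

(** For s <= 0 all terms are at least 1, so the first two already add up to more than 1. This gives
    uniqueness among all real s. *)
Lemma dimension_equation_gt0 a s : 0 <= a -> dimension_equation a s -> 0 < s.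
Proof.
move=> a0; apply: contraPT; rewrite -leNgt => s0 /eqP; apply/negP.
rewrite gt_eqF// (@lt_le_trans _ _ 2%:E)//; first by rewrite lte_fin ltr1n.
apply: (le_trans _ (nneseries_lim_ge 3 _)) => [|n _ _]; last first.
  by rewrite lee_fin powR_ge0.
rewrite sumEFin lee_fin big_ltn// big_nat1 !dimension_equation_term.
have a1 : 1 <= 2 `^ (- (a * s)) :> R.
  by rewrite -[leLHS](powRr0 2) ler_powR2 oppr_ge0 mulr_ge0_le0.
have s1 : 1 <= 2 `^ (- s) :> R by rewrite -[leLHS](powRr0 2) ler_powR2 oppr_ge0.
rewrite expr1 expr2.
move: (2 `^ _) (2 `^ _) a1 s1 => u v v1 u1.
have : 1 <= v * u by rewrite mulr_ege1.
have : 1 <= v * (u * u) by rewrite !mulr_ege1.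
lra.
Qed.

Lemma dimension_function_continuous b : continuous (dimension_function b).
Proof.
move=> x; apply: cvgM.
  apply: (@continuous_comp _ _ _ ( *%R b) (powR 2)); first exact: mulrl_continuous.
  exact: continuous_powR2.
by apply: cvgB; [exact: continuous_powR2|exact: cvg_cst].
Qed.

(** Continuity in [b] lets a strict inequality against 1 survive a small change of [b]: from 0 to a
    positive value if r < 1, from alpha to a smaller value if r = 1. *)
Lemma dimension_functionC_continuous t : continuous (dimension_function ^~ t).
Proof.
move=> x; apply: cvgM; last exact: cvg_cst.
apply: (@cvg_comp _ _ _ (fun b => b * t) (powR 2) _ (nbhs (x * t))).
  exact: mulrr_continuous.
exact: continuous_powR2.
Qed.

Lemma dimension_equation_solvable a : 0 <= a ->
  exists s, [/\ 0 < s, unique (dimension_equation a) s & dimension_function a s = 1].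
Proof.
move=> a0.
(* F(a, 0) = 0 and F(a, 1) = 2^a >= 1. *)
have [s _ sE] : exists2 s, s \in `[0, 1] & dimension_function a s = 1.
  apply: IVT => //.
    exact/continuous_subspaceT/dimension_function_continuous.
  rewrite /dimension_function mulr0 powRr0 subrr mulr0 mulr1 powRr1//.
  have : 1 <= 2 `^ a :> R by rewrite -[leLHS](powRr0 2) ler_powR2.
  rewrite ge_min le_max ler01/= => ?; apply/orP; right; lra.
have s0 : 0 < s.
  rewrite ltNge; apply/negP => s0.
  have : dimension_function a s <= 0.
    rewrite mulr_ge0_le0 ?powR_ge0// subr_le0 -[leRHS](powRr0 2) ler_powR2//.
  by rewrite sE; lra.
exists s; split => //; split; first exact/dimension_equationE.
move=> s' es'; have s'0 := dimension_equation_gt0 a0 es'.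
move/(dimension_equationE a s'0) : es' => s'E.
apply/eqP; rewrite eq_le !leNgt; apply/andP; split; apply/negP => ss.
  by have := dimension_function_mono a0 (ltW s'0) ss; rewrite sE s'E ltxx.
by have := dimension_function_mono a0 (ltW s0) ss; rewrite sE s'E ltxx.
Qed.

End dimension_function.

(** * Upper bounds *)

Section upper_bound.
Context {R : realType}.
Implicit Types (r alpha b c t x kappa : R) (A : set R).

Definition digit_ge n kappa : set R :=
  [set x | 0 < x <= 1 /\ kappa <= (digit n x)%:R].

Lemma digit_ge1_dist kappa x y : digit_ge 1 kappa x -> digit_ge 1 kappa y ->
  `|x - y| <= 2 `^ (1 - kappa).
Proof.
have H z : digit_ge 1 kappa z -> 0 < z <= 2 `^ (1 - kappa).
  move=> [z01 kz]; have /andP[-> _]/= := z01.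
  have [d0 /andP[_ zd]] := digit1_specP z01; apply: (le_trans zd).
  rewrite -(powR_mulrn _ (ler0n _ 2)) -powRN ler_powR2 lerNl opprB.
  have -> : (digit1 z).-1%:R = (digit1 z)%:R - 1 :> R.
    by rewrite -{2}(prednK d0) -natr1 addrK.
  by rewrite lerD2r.
move=> /H/andP[x0 x1] /H/andP[y0 y1]; rewrite ler_norml; apply/andP; split; lra.
Qed.

(** The inverse branch of [decayT] for the digit [k], a contraction by 2^(-k). *)
Definition branch k x : R := 2 ^- k * (1 + x).

Lemma branch_decayT x : 0 < x <= 1 -> branch (digit1 x) (decayT x) = x.
Proof. by move=> x01; rewrite /branch /decayT addrC subrK mulKf// expf_neq0. Qed.

Lemma digit_geS n kappa :
  digit_ge n.+2 kappa `<=` \bigcup_k (branch k.+1 @` digit_ge n.+1 kappa).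
Proof.
move=> x [x01 kx]; have [d0 _] := digit1_specP x01.
exists (digit1 x).-1 => //; exists (decayT x); last by rewrite prednK// branch_decayT.
by split; [exact: decayT_itv|rewrite -digit_decayT].
Qed.

(** Induction on the position: peeling off a first digit k rescales the content by 2^(-kt), and
    these factors sum to 1 / (2^t - 1). *)
Lemma hausdorff_content_digit_ge t n kappa : 0 < t ->
  (hausdorff_content t (digit_ge n.+1 kappa) <=
   (2 `^ ((1 - kappa) * t) * (2 `^ t - 1)^-1 ^+ n)%:E)%E.
Proof.
move=> t0; elim: n => [|n IH].
  rewrite expr0 mulr1 powRrM.
  apply: (le_trans (hausdorff_content_le_diam_pow _ _)).
  by apply: diam_pow_le; [exact: ltW|exact: digit_ge1_dist].
apply: (le_trans (le_hausdorff_content _ (@digit_geS n kappa))).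
apply: (le_trans (hausdorff_content_bigcup _ _)).
have p : 0 < 2 `^ t - 1 :> R by rewrite subr_gt0 gt1_powR2.
set u := (X in X%:E) in IH.
have u0 : 0 <= u by rewrite mulr_ge0 ?powR_ge0// exprn_ge0// invr_ge0 ltW.
rewrite exprS mulrCA mulrC -eseries_powR2// -(nneseries_addn 1); last first.
  by move=> i; rewrite lee_fin mulr_ge0// exprn_ge0// powR_ge0.
apply: lee_nneseries => k _; first by move=> _; exact: hausdorff_content_ge0.
rewrite addn1 mulrC EFinM -powR2_exprn.
have k0 : 0 < 2 ^- k.+1 :> R by rewrite invr_gt0 exprn_gt0.
apply: (@le_trans _ _ (((2 ^- k.+1) `^ t)%:E * hausdorff_content t (digit_ge n.+1 kappa))%E).
  apply: hausdorff_content_lipschitz => // [|x y]; first exact: ltW.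
  by rewrite /branch -mulrBr opprD addrACA subrr add0r normrM gtr0_norm.
by apply: lee_wpmul2l => //; rewrite lee_fin powR_ge0.
Qed.

Lemma hausdorff_measure_upper A b t : 0 < t -> 1 < dimension_function b t ->
  (forall x, A x -> 0 < x <= 1 /\
    forall N, exists2 n, (N <= n)%N & b * n.+1%:R <= (digit n.+1 x)%:R) ->
  hausdorff_measure t A = 0%E.
Proof.
move=> t0 bt AD; apply: hausdorff_measure_eq0 => //.
have p : 0 < 2 `^ t - 1 :> R by rewrite subr_gt0 gt1_powR2.
(* With kappa = b (n + 1), the content bound for position n + 1 is exactly c q^n. *)
pose q : R := (dimension_function b t)^-1.
have q01 : 0 <= q < 1.
  by rewrite invr_ge0 invf_lt1 ?bt ?andbT//; [exact/ltW/(lt_trans _ bt)|exact: lt_trans bt].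
pose c : R := 2 `^ ((1 - b) * t).
have c0 : 0 <= c by exact: powR_ge0.
have hN N : (hausdorff_content t A <= (c / (1 - q) * q ^+ N)%:E)%E.
  have AU : A `<=` \bigcup_i digit_ge (i + N).+1 (b * (i + N).+1%:R).
    move=> x /AD[x01 /(_ N)[n Nn bn]]; exists (n - N)%N => //.
    by split; rewrite ?subnK.
  apply: (le_trans (le_hausdorff_content _ AU)).
  apply: (le_trans (hausdorff_content_bigcup _ _)).
  rewrite mulrAC -eseries_geometric//; apply: lee_nneseries => i _.
    by move=> _; exact: hausdorff_content_ge0.
  apply: (le_trans (hausdorff_content_digit_ge _ _ t0)); rewrite lee_fin.
  rewrite -mulrA -exprD addnC le_eqVlt; apply/orP; left; apply/eqP.
  rewrite /c /q /dimension_function invfM exprMn mulrA; congr (_ * _).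
  rewrite -powRN -powR_mulrn ?powR_ge0// -powRrM -powR2D; congr (_ `^ _).
  by rewrite -natr1; ring.
apply/eqP; rewrite eq_le hausdorff_content_ge0 andbT.
apply/lee_addgt0Pr => e e0; rewrite add0e.
have : geometric (c / (1 - q)) q n @[n --> \oo] --> 0.
  by apply: cvg_geometric; rewrite ger0_norm; case/andP: q01.
move=> /cvgrPdist_lt/(_ e e0)[N _ /(_ N (leqnn N))]; rewrite sub0r normrN => /ltW cN.
by rewrite (le_trans (hN N))// lee_fin (le_trans _ cN)// ler_norm.
Qed.

Lemma powR_nat_unbounded (u r : R) : 0 < r ->
  exists N, forall n, (N <= n)%N -> u <= n%:R `^ r.
Proof.
move=> r0; have [u0|u0] := leP u 0.
  by exists 0%N => n _; rewrite (le_trans u0)// powR_ge0.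
exists (Num.bound (u `^ r^-1)) => n nN.
have uE : u = (u `^ r^-1) `^ r by rewrite -powRrM mulVf ?gt_eqF// powRr1// ltW.
rewrite [leLHS]uE; apply: ge0_ler_powR; rewrite ?nnegrE ?powR_ge0//; first exact: ltW.
by rewrite (le_trans (ltW (archi_boundP (powR_ge0 _ _))))// ler_nat.
Qed.

Lemma max_digitS n x : max_digit n.+1 x = maxn (max_digit n x) (digit n.+1 x).
Proof. by rewrite /max_digit big_nat_recr. Qed.

Lemma digit_le_max_digit n i x : (0 < i <= n)%N -> (digit i x <= max_digit n x)%N.
Proof.
move=> i0n; rewrite /max_digit (bigD1_seq i) ?iota_uniq ?mem_index_iota//=.
exact: leq_maxl.
Qed.

Lemma max_digit_attained n x : (0 < max_digit n x)%N ->
  exists2 i, (0 < i <= n)%N & digit i x = max_digit n x.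
Proof.
elim: n => [|n IH]; first by rewrite /max_digit big_geq.
rewrite max_digitS; case: (leqP (max_digit n x) (digit n.+1 x)) => [_ _|_ L0].
  by exists n.+1 => //=.
by have [i /andP[i0 ilen] iL] := IH L0; exists i; rewrite ?i0 ?leqW.
Qed.

(** A maximum above a n^r, attained at a position i + 1 <= n, is a digit above a (i + 1)^r. Once a
    n^r outgrows the first M digits, this position must lie beyond M. *)
Lemma digits_of_limsup_set r alpha a b x : 0 < r -> 0 < a < alpha ->
  (exists N, forall n, (N <= n)%N -> b * n%:R <= a * n%:R `^ r) ->
  limsup_set r alpha x ->
  0 < x <= 1 /\
    forall N, exists2 n, (N <= n)%N & b * n.+1%:R <= (digit n.+1 x)%:R.
Proof.
move=> r0 /andP[a0 aalpha] [N1 bN1] [x01 limx]; split=> // N.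
have io M : exists2 n, (M <= n)%N & a < (max_digit n x)%:R / n%:R `^ r.
  apply/not_exists2P => H.
  have : (alpha%:E <= a%:E)%E; last by rewrite lee_fin leNgt aalpha.
  rewrite -limx; apply: (le_trans (ereal_inf_lbound _)).
    by exists [set k | (M <= k)%N] => //; exists M.
  apply: ge_ereal_sup => _ [k /= Mk <-]; rewrite lee_fin leNgt; apply/negP => ak.
  by case: (H k).
pose M := maxn N N1.
have [K KM] := powR_nat_unbounded ((max_digit M x)%:R / a) r0.
have [n] := io (maxn K 1); rewrite geq_max => /andP[Kn n0].
rewrite ltr_pdivlMr ?powR_gt0 ?ltr0n// => aL.
have L0 : (0 < max_digit n x)%N.
  by rewrite -(ltr_nat R) (le_lt_trans _ aL)// mulr_ge0 ?powR_ge0// ltW.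
have [[//|i] /andP[_ ilen] iL] := max_digit_attained L0.
have Mi : (M <= i)%N.
  rewrite leqNgt; apply/negP => iM.
  have := @digit_le_max_digit M i.+1 x iM; rewrite iL -(ler_nat R).
  rewrite leNgt (le_lt_trans _ aL)//.
  by rewrite -ler_pdivrMl// mulrC KM.
exists i; first by rewrite (leq_trans _ Mi)// leq_maxl.
rewrite iL (le_trans (bN1 _ _))//.
  by rewrite (leq_trans (leq_trans (leq_maxr _ _) Mi)).
rewrite (le_trans _ (ltW aL))// ler_pM2l//.
by apply: ge0_ler_powR; rewrite ?nnegrE ?ler_nat// ltW.
Qed.

End upper_bound.

(** * Prescribing digits *)

Section digits.
Context {R : realType}.
Implicit Types (r alpha x y : R) (d : nat -> nat).

Lemma is_expansion_exists d : (forall i, (0 < i)%N -> (0 < d i)%N) ->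
  exists x : R, is_expansion d x.
Proof.
move=> d0; exists (limn (partial_expansion d)); split=> //.
apply: nondecreasing_is_cvgn.
  apply/nondecreasing_seqP => n; rewrite /partial_expansion [leRHS]big_nat_recr//=.
  by rewrite lerDl invr_ge0 exprn_ge0.
by exists 1 => _ [n _ <-]; have /andP[] := @partial_expansion_itv R d n d0.
Qed.

(* The digit after the first difference keeps [x] away from the left endpoint
   of its cylinder. *)
Lemma digit_gap n x y : 0 < x <= 1 -> 0 < y <= 1 ->
  (forall i, (i < n)%N -> digit i.+1 x = digit i.+1 y) ->
  (digit n.+1 x < digit n.+1 y)%N ->
  2 ^- (\sum_(i < n.+2) digit i.+1 x) <= x - y.
Proof.
elim: n x y => [|n IH] x y x01 y01 eqd ltd.
  (* A smaller first digit means a larger point: y <= 2^(-d_1(x)), while x = 2^(-d_1(x)) (1 + T x)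
     and T x > 2^(-d_2(x)). *)
  rewrite big_ord_recl big_ord_recl big_ord0 addn0 exprD invfM /=.
  rewrite (_ : digit (bump 0 0).+1 x = digit1 (decayT x)); last by [].
  rewrite -{3}(branch_decayT x01) /branch.
  have /andP[Tx _] := (digit1_specP (decayT_itv x01)).2.
  have /andP[_ yd] := (digit1_specP y01).2.
  have : y <= 2 ^- digit1 x.
    apply: (le_trans yd); rewrite lef_pV2 ?posrE ?exprn_gt0// ler_weXn2l ?ler1n//.
    by move: ltd; rewrite /digit/=; case: (digit1 y).
  have p : 0 < 2 ^- digit1 x :> R by rewrite invr_gt0 exprn_gt0.
  rewrite -[digit 1 x]/(digit1 x); move: p Tx.
  move: (decayT x) (2 ^- digit1 (decayT x)) (2 ^- digit1 x) => w v u; nra.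
have x1y1 : digit1 x = digit1 y := eqd 0%N isT.
have IHn := IH _ _ (decayT_itv x01) (decayT_itv y01).
rewrite big_ord_recl exprD invfM -[in leRHS](branch_decayT x01).
rewrite -[in leRHS](branch_decayT y01) -x1y1 /branch -mulrBr opprD addrACA subrr add0r.
rewrite ler_pM2l ?invr_gt0 ?exprn_gt0//.
under eq_bigr => i _ do rewrite (digit_decayT _ (ltn0Sn i)).
by apply: IHn => [i ilen|]; rewrite -!digit_decayT//; exact: eqd.
Qed.

(** [D] absorbs the bounded digits: it is eventually at most alpha n^r. *)
Lemma limsup_set_of_digits r alpha D x : 0 < r -> 0 < alpha -> 0 < x <= 1 ->
  (forall n, (digit n.+1 x)%:R <= Num.max D (alpha * n.+1%:R `^ r)) ->
  (forall N, exists2 n, (N <= n)%N & alpha * n.+1%:R `^ r - 1 <= (digit n.+1 x)%:R) ->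
  limsup_set r alpha x.
Proof.
move=> r0 a0 x01 dle dge; split=> //; apply/eqP; rewrite eq_le; apply/andP; split.
  have [K KD] := powR_nat_unbounded (D / alpha) r0.
  apply: (le_trans (ereal_inf_lbound _)).
    by exists [set k | (K.+1 <= k)%N] => //; exists K.+1.
  apply: ge_ereal_sup => _ [n /= Kn <-]; rewrite lee_fin.
  rewrite ler_pdivrMr ?powR_gt0 ?ltr0n ?(leq_ltn_trans _ Kn)//.
  have [->|/negP/negP] := eqVneq (max_digit n x) 0%N.
    by rewrite mulr_ge0 ?powR_ge0// ltW.
  rewrite -lt0n => /max_digit_attained[[//|i] /andP[_ ilen] <-].
  apply: (le_trans (dle i)); rewrite ge_max; apply/andP; split.
    by rewrite -ler_pdivrMl// mulrC KD// ltnW.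
  by rewrite ler_pM2l//; apply: ge0_ler_powR; rewrite ?nnegrE ?ler_nat// ltW.
apply: le_ereal_inf_tmp => _ [V [N _ NV] <-]; apply/lee_subgt0Pr => e e0.
(* From [K] on, the loss of 1 by rounding is at most [e] after division by n^r. *)
have [K Ke] := powR_nat_unbounded e^-1 r0.
have [n Kn dn] := dge (maxn N K).
rewrite (@le_trans _ _ ((max_digit n.+1 x)%:R / n.+1%:R `^ r)%:E)//; last first.
  apply: ereal_sup_ubound; exists n.+1 => //; apply: NV => /=.
  by rewrite (leq_trans (leq_maxl N K))// leqW.
have p : 0 < n.+1%:R `^ r :> R by rewrite powR_gt0.
rewrite -EFinB lee_fin ler_pdivlMr//.
apply: (@le_trans _ _ (digit n.+1 x)%:R); last by rewrite ler_nat digit_le_max_digit ?leqnn.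
apply: le_trans dn; rewrite mulrBl lerB// mulrC -ler_pdivrMr// div1r Ke//.
by rewrite (leq_trans (leq_maxr N K))// leqW.
Qed.

End digits.

(** * Sparse sets of positions *)

Section sparse.
Local Open Scope nat_scope.

(** For B > 1, [trunc_log] jumps exactly when i + 1 is a power B^k with k >= 1; the index [i] stands
    for the digit i + 1. *)
Definition is_power B i := trunc_log B i < trunc_log B i.+1.

Lemma is_powerE B i : 1 < B -> is_power B i -> i.+1 = B ^ (trunc_log B i).+1.
Proof.
move=> B1 pi; apply/eqP; rewrite eqn_leq trunc_log_ltn//=.
by rewrite (leq_trans _ (trunc_logP B1 (ltn0Sn i)))// leq_exp2l.
Qed.

Lemma is_power_infinite B N : 1 < B -> exists2 n, N <= n & is_power B n.
Proof.
move=> B1; exists (B ^ N.+1).-1.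
  by rewrite -ltnS prednK ?expn_gt0 ?(ltnW B1)// (ltn_trans (ltnSn N))// ltn_expl.
have B0 : 0 < B ^ N.+1 by rewrite expn_gt0 (ltnW B1).
rewrite /is_power prednK// trunc_expnK// -(ltn_exp2l _ _ B1).
rewrite -[X in _ < X](prednK B0) ltnS trunc_logP// -ltnS prednK//.
by rewrite -(expn0 B) ltn_exp2l.
Qed.

Lemma count_is_power B N : 1 < B -> B * \sum_(i < N | is_power B i) 1 <= N.
Proof.
move=> B1; have : \sum_(i < N | is_power B i) 1 <= trunc_log B N.
  elim: N => [|N IH]; first by rewrite big_ord0.
  rewrite big_mkcond big_ord_recr -big_mkcond/=.
  have [pN|pN] := ifPn; last by rewrite addn0 (leq_trans IH)// leq_trunc_log.
  by rewrite addn1 (leq_ltn_trans IH).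
move=> /(leq_mul (leqnn B))/leq_trans; apply.
case: N => [|N]; first by rewrite trunc_log0 muln0.
apply: leq_trans (trunc_logP B1 (ltn0Sn N)).
case: (trunc_log _ _) => [|k]; first by rewrite muln0.
by rewrite expnS leq_pmul2l ?(ltnW B1)// ltn_expl.
Qed.

(** The geometric sum B + ... + B^k is at most B^(k + 1) / (B - 1), and B^k <= N. *)
Lemma sum_is_power B N : 1 < B -> B.-1 * \sum_(i < N | is_power B i) i.+1 <= B * N.
Proof.
move=> B1; case: N => [|N]; first by rewrite big_ord0 muln0.
suff H n : B.-1 * \sum_(i < n | is_power B i) i.+1 <= B ^ (trunc_log B n).+1.
  by rewrite (leq_trans (H _))// expnS leq_pmul2l ?(ltnW B1)// trunc_logP.
elim: n => [|n IH]; first by rewrite big_ord0 muln0.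
rewrite big_mkcond big_ord_recr -big_mkcond/=.
have [pn|pn] := ifPn; last by rewrite addn0 (leq_trans IH)// leq_exp2l// ltnS leq_trunc_log.
rewrite mulnDr (leq_trans (leq_add IH (leqnn _)))// (is_powerE B1 pn) -mulSn.
by rewrite prednK ?(ltnW B1)// -expnS leq_exp2l// trunc_expnK.
Qed.

End sparse.

(** Powers of a large base. The last chosen position alone may contribute [N] to the second sum, so
    no constant below 1 is possible there. *)
Lemma sparse_set (R : realType) (e : R) : 0 < e ->
  exists J : pred nat, [/\ forall N, exists2 n, (N <= n)%N & J n,
    forall N, \sum_(i < N | J i) 1 <= e * N%:R &
    forall N, \sum_(i < N | J i) i.+1%:R <= (1 + e) * N%:R].
Proof.
(* This choice gives 1 / (B - 1) <= e, hence B / (B - 1) <= 1 + e. *)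
move=> e0; pose B := (Num.bound e^-1).+2.
have B1 : (1 < B)%N by [].
have eB : 1 <= e * B.-1%:R.
  rewrite mulrC -ler_pdivrMr// div1r /B/= -natr1.
  by rewrite (le_trans (ltW (archi_boundP _)))// ?lerDl// invr_ge0 ltW.
have B0 : 0 < B.-1%:R :> R by rewrite ltr0n.
exists (is_power B); split=> N.
- exact: is_power_infinite.
- have := count_is_power N B1; rewrite -(ler_nat R) natrM natr_sum.
  set s := \sum_(_ < N | _) _; have s0 : 0 <= s by apply: sumr_ge0.
  move=> BsN; have : (e * B%:R) * s <= e * N%:R by rewrite -mulrA ler_pM2l.
  apply: le_trans; rewrite ler_peMl// (le_trans eB)// ler_pM2l// ler_nat.
  exact: leq_pred.
- have := sum_is_power N B1; rewrite -(ler_nat R) !natrM natr_sum.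
  set s := \sum_(_ < N | _) _ => BsN.
  rewrite -(ler_pM2l B0) (le_trans BsN)// mulrA ler_wpM2r//.
  rewrite mulrDr mulr1 -[in leLHS](prednK (ltnW B1)) -natr1 lerD2l mulrC//.
Qed.

(** * Coding of points by words *)

Lemma dist_le1 (R : realType) (x y : R) : 0 < x <= 1 -> 0 < y <= 1 -> `|x - y| <= 1.
Proof.
by move=> /andP[? ?] /andP[? ?]; rewrite ler_norml; apply/andP; split; lra.
Qed.

(* Each point of (0, 1] is coded by the intervals of lengths [w 1], ..., [w M];
   the letters [m n] are inserted at the positions [n] in [J]. *)
Section coding.
Context {R : realType} (w : nat -> R) (M : nat) (J : pred nat) (m : nat -> nat).
Hypothesis w_gt0 : forall k, 0 < w k.
Hypothesis w_ge1 : 1 <= \sum_(1 <= k < M.+1) w k.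
Implicit Types (y z : R).

Definition cumul k : R := \sum_(1 <= i < k.+1) w i.

(** The list starts at 0, where [cumul] vanishes, so the index found is the letter itself and is
    positive for y > 0. *)
Definition code y : nat := find (fun k => y <= cumul k) (iota 0 M.+1).

Lemma codeP y : 0 < y <= 1 ->
  (0 < code y <= M)%N /\ cumul (code y).-1 < y <= cumul (code y).
Proof.
move=> /andP[y0 y1].
have hy : has (fun k => y <= cumul k) (iota 0 M.+1).
  by apply/hasP; exists M; rewrite ?mem_iota ?add0n ?leqnn// (le_trans y1).
have cM : (code y < M.+1)%N by rewrite -[M.+1](size_iota 0) -has_find.
have yc : y <= cumul (code y).
  by have := nth_find 0 hy; rewrite nth_iota ?add0n.
have c0 : (0 < code y)%N.
  rewrite lt0n; apply/eqP => c0; move: yc; rewrite c0 /cumul big_geq//.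
  by rewrite leNgt y0.
rewrite c0 -ltnS cM yc andbT; split=> //.
have /(before_find 0)/negbT : ((code y).-1 < code y)%N by rewrite prednK.
rewrite nth_iota; last exact: leq_ltn_trans (leq_pred _) cM.
by rewrite add0n -ltNge => ->.
Qed.

Definition zoom y : R := (y - cumul (code y).-1) / w (code y).

Lemma zoomK y : y = cumul (code y).-1 + w (code y) * zoom y.
Proof. by rewrite /zoom mulrCA divff ?gt_eqF// mulr1 addrC subrK. Qed.

Lemma zoom_itv y : 0 < y <= 1 -> 0 < zoom y <= 1.
Proof.
move=> /codeP[/andP[c0 _] /andP[cy yc]].
rewrite /zoom divr_gt0 ?subr_gt0//= ler_pdivrMr// mul1r lerBlDl.
apply: (le_trans yc); rewrite /cumul -{1}(prednK c0) big_nat_recr//=.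
by rewrite prednK.
Qed.

(** At positions in [J] the state is kept, so the inserted letters use up no information about
    [y]. *)
Fixpoint state y n : R :=
  if n is k.+1 then if J k then state y k else zoom (state y k) else y.

Lemma state_itv y n : 0 < y <= 1 -> 0 < state y n <= 1.
Proof. by move=> y01; elim: n => //= n IH; case: ifP => // _; exact: zoom_itv. Qed.

Definition word y n : nat := if J n then m n else code (state y n).

Definition weight y n : R := \prod_(i < n | ~~ J i) w (word y i).

Lemma weightS y n :
  weight y n.+1 = weight y n * (if J n then 1 else w (word y n)).
Proof. by rewrite /weight big_mkcond big_ord_recr -big_mkcond/=; case: (J n). Qed.

Lemma weight_ge0 y n : 0 <= weight y n.
Proof. by apply: prodr_ge0 => i _; exact: ltW. Qed.

(** Each common letter at a free position [i] contributes the factor [w (word y i)] to the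
    difference; inserted letters contribute none. *)
Lemma dist_word y z n : (forall i, (i < n)%N -> word y i = word z i) ->
  y - z = weight y n * (state y n - state z n).
Proof.
elim: n => [_|n IH eqw]; first by rewrite /weight big_ord0 mul1r.
rewrite IH => [|i ilen]; last by rewrite eqw// ltnW.
rewrite weightS -mulrA; congr (_ * _) => /=.
have := eqw n (ltnSn n); rewrite /word; case: (J n); first by rewrite mul1r.
move=> cyz; rewrite {1}(zoomK (state y n)) {1}(zoomK (state z n)) -cyz.
by rewrite opprD addrACA subrr add0r mulrBr.
Qed.

Lemma le_dist_word y z n : 0 < y <= 1 -> 0 < z <= 1 ->
  (forall i, (i < n)%N -> word y i = word z i) -> `|y - z| <= weight y n.
Proof.
move=> y01 z01 /dist_word ->; rewrite normrM ger0_norm ?weight_ge0//.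
by rewrite ler_piMr ?weight_ge0// dist_le1// state_itv.
Qed.

Lemma word_le y n : 0 < y <= 1 -> ~~ J n -> (word y n <= M)%N.
Proof.
move=> y01 /negbTE Jn; rewrite /word Jn.
by have [/andP[]] := codeP (state_itv n y01).
Qed.

Lemma word_gt0 y n : (forall i, 0 < m i)%N -> 0 < y <= 1 -> (0 < word y n)%N.
Proof.
move=> m0 y01; rewrite /word; case: ifP => // _.
by have [/andP[]] := codeP (state_itv n y01).
Qed.

(** [digit_gap] involves [n.+2] digits for a first difference at [n]; the last two letters, when
    free, cost at most [M] each. *)
Lemma sum_word_le y n : 0 < y <= 1 ->
  (\sum_(i < n.+2) word y i <=
   \sum_(i < n | ~~ J i) word y i + \sum_(i < n.+2 | J i) m i + M.*2)%N.
Proof.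
move=> y01; rewrite (bigID (fun i : 'I_n.+2 => J i))/= addnC addnAC; apply: leq_add.
  rewrite big_mkcond !big_ord_recr -big_mkcond/= -addnA leq_add2l -addnn.
  apply: leq_add; case: ifP => //; exact: word_le.
by rewrite leq_eqVlt; apply/orP; left; apply/eqP/eq_bigr => i; rewrite /word => ->.
Qed.

End coding.

(** * Weights that are powers of 2 *)

Section coding_powR2.
Context {R : realType} (b s : R) (M : nat) (J : pred nat) (m : nat -> nat).
Let w k : R := 2 `^ (- ((b + k%:R) * s)).
Implicit Types (y z t c e : R).
Local Notation word := (word w M J m).
Local Notation weight := (weight w M J m).
Hypothesis w_ge1 : 1 <= \sum_(1 <= k < M.+1) w k.

Let w_gt0 k : 0 < w k. Proof. exact: powR2_gt0. Qed.

Lemma weightE y n :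
  weight y n = 2 `^ (- (s * \sum_(i < n | ~~ J i) (b + (word y i)%:R))).
Proof.
rewrite mulr_sumr -sumrN (big_morph (powR 2) (@powR2D R) (powRr0 2)).
by apply: eq_bigr => i _; rewrite /w mulrC.
Qed.

(** The core of the Hoelder estimate: at least (1 - e) n free positions each gain s b in the
    exponent, which pays for t times the sum of the inserted digits. The constant covers the last
    two letters and the passage from n to n + 2. *)
Lemma weight_le t c e y n : 0 <= t <= s -> 0 <= b -> 0 <= c -> 0 < y <= 1 ->
  (forall i, (m i)%:R <= b * i.+1%:R + c) ->
  (forall N, \sum_(i < N | J i) 1 <= e * N%:R) ->
  (forall N, \sum_(i < N | J i) i.+1%:R <= (1 + e) * N%:R) ->
  t * (b * (1 + e) + c * e) <= s * b * (1 - e) ->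
  weight y n <= 2 `^ (2 * t * M%:R + 2 * s * b * (1 - e)) *
    2 `^ (- (t * (\sum_(i < n.+2) word y i)%:R)).
Proof.
move=> /andP[t0 ts] b0 c0 y01 mle J1 Ji te.
rewrite weightE -powR2D ler_powR2.
have := sum_word_le J m w_gt0 w_ge1 n y01; rewrite -(ler_nat R) !natrD.
set S := (\sum_(i < n.+2) _)%:R; set S0 : R := (\sum_(i < n | _) _)%:R.
set Sm : R := (\sum_(i < n.+2 | _) _)%:R => Sle.
have -> : \sum_(i < n | ~~ J i) (b + (word y i)%:R) =
    b * \sum_(i < n | ~~ J i) 1 + S0.
  rewrite big_split/= /S0 natr_sum mulr_sumr; congr (_ + _).
  by apply: eq_bigr => i _; rewrite mulr1.
have cn : \sum_(i < n | ~~ J i) 1 >= n%:R - e * n%:R :> R.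
  have : \sum_(i < n | J i) 1 + \sum_(i < n | ~~ J i) 1 = n%:R :> R.
    by rewrite -[in RHS](card_ord n) -sumr_const [RHS](bigID (fun i : 'I_n => J i)).
  by have := J1 n; lra.
have Sm_le : Sm <= (b * (1 + e) + c * e) * n.+2%:R.
  rewrite /Sm natr_sum.
  apply: (@le_trans _ _ (\sum_(i < n.+2 | J i) (b * i.+1%:R + c * 1))).
    by apply: ler_sum => i _; rewrite mulr1.
  rewrite big_split/= -!mulr_sumr mulrDl -!mulrA. apply: lerD.
    by apply: ler_wpM2l => //; exact: Ji.
  by apply: ler_wpM2l => //; exact: J1.
have S00 : 0 <= S0 by [].
have M0 : 0 <= M%:R :> R by [].
have n0 : 0 <= n%:R :> R by [].
have s0 : 0 <= s by exact: le_trans ts.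
have tSm : t * Sm <= s * b * (1 - e) * n.+2%:R.
  apply: (le_trans (ler_wpM2l t0 Sm_le)); rewrite mulrA.
  by apply: ler_wpM2r.
have tS : t * S <= t * (S0 + Sm + M.*2%:R) by apply: ler_wpM2l.
have tS0 : t * S0 <= s * S0 by apply: ler_wpM2r.
have scn : s * b * (n%:R - e * n%:R) <= s * b * \sum_(i < n | ~~ J i) 1.
  by apply: ler_wpM2l => //; rewrite mulr_ge0.
move: tS tSm scn; rewrite -mul2n natrM -[n.+2]addn2 natrD => tS tSm scn.
rewrite mulrDr mulrA.
move: (s * b * \sum_(i < n | ~~ J i) 1) scn => Z scn.
lra.
Qed.

End coding_powR2.

(** * Lower bounds and the dimension formula *)

(** The full series sums to 1 / F(b, s) > 1, so finitely many weights suffice and the alphabet is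
    bounded. *)
Lemma partial_sum_ge1 (R : realType) (b s : R) : 0 < s -> dimension_function b s < 1 ->
  exists M, 1 <= \sum_(1 <= k < M.+1) 2 `^ (- ((b + k%:R) * s)) :> R.
Proof.
move=> s0 bs1; apply/not_existsP => H.
have p : 0 < dimension_function b s.
  by rewrite mulr_gt0 ?powR2_gt0// subr_gt0 gt1_powR2.
have : ((2 `^ (- (b * s)) / (2 `^ s - 1))%:E <= 1%:E :> \bar R)%E.
  rewrite -eseries_powR2 ?powR_ge0//; apply: lime_le.
    by apply: is_cvg_nneseries => k _ _; rewrite lee_fin mulr_ge0 ?exprn_ge0 ?powR_ge0.
  apply: nearW => -[|M]; first by rewrite big_geq.
  rewrite sumEFin lee_fin; have /negP := H M; rewrite -ltNge => /ltW; apply: le_trans.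
  rewrite le_eqVlt; apply/orP; left; apply/eqP/eq_bigr => k _.
  rewrite -powR_mulrn ?powR_ge0// -powRrM -powR2D; congr (_ `^ _); ring.
by rewrite powRN -invfM lee_fin leNgt invf_gt1// bs1.
Qed.

Lemma hausdorff_measure_lower (R : realType) (r alpha b s c t : R) :
  0 < r -> 0 < alpha -> 0 < b -> dimension_function b s < 1 -> 0 <= c ->
  (forall n, alpha * n%:R `^ r <= b * n%:R + c) -> 0 <= t < s ->
  hausdorff_measure t (limsup_set r alpha) <> 0%E.
Proof.
move=> r0 a0 b0 bs1 c0 anr /andP[t0 ts].
have s0 : 0 < s by exact: le_lt_trans ts.
(* The intermediate exponent leaves room on both sides: u < s makes [e] positive, and u > 0 holds
   even when t = 0. *)
pose u := (t + s) / 2.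
have u0 : 0 < u by rewrite /u; lra.
have us : u < s by rewrite /u; lra.
have tu : t <= u by rewrite /u; lra.
have [M wM] := partial_sum_ge1 s0 bs1.
pose w k : R := 2 `^ (- ((b + k%:R) * s)).
have w0 k : 0 < w k by exact: powR2_gt0.
(* [e] solves [ueq] with equality, which is linear in [e]. *)
pose den := u * b + u * (c + 1) + s * b.
have den0 : 0 < den by rewrite !addr_gt0// mulr_gt0// ltr_wpDl.
pose e := (s - u) * b / den.
have e0 : 0 < e by rewrite divr_gt0// mulr_gt0// subr_gt0.
have ueq : u * (b * (1 + e) + (c + 1) * e) <= s * b * (1 - e).
  have : e * den = (s - u) * b by rewrite /e divfK// gt_eqF.
  by rewrite /den; lra.
have [J [Jinf J1 Ji]] := sparse_set e0.
(* Digits must be positive, hence the maximum with 1, which the bound c + 1 in [mle]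
   accommodates. *)
pose m i := maxn 1 (Num.truncn (alpha * i.+1%:R `^ r)).
have anr0 n : 0 <= alpha * n%:R `^ r by rewrite mulr_ge0 ?powR_ge0// ltW.
have m0 i : (0 < m i)%N by rewrite leq_max.
have mle i : (m i)%:R <= b * i.+1%:R + (c + 1).
  have /andP[tr _] := truncn_itv (anr0 i.+1).
  have bi : 0 <= b * i.+1%:R by rewrite mulr_ge0// ltW.
  rewrite /m; case: leqP => _; first by rewrite (le_trans tr)// (le_trans (anr _))//; lra.
  lra.
have gex y : exists x : R, 0 < y <= 1 ->
    0 < x <= 1 /\ forall i, digit i.+1 x = word w M J m y i.
  have [y01|ny01] := boolP (0 < y <= 1); last by exists 0.
  have dpos i : (0 < i)%N -> (0 < word w M J m y i.-1)%N.
    by move=> _; exact: word_gt0.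
  have [x /digit_expansion_unique[x01 xd]] := @is_expansion_exists R _ dpos.
  by exists x => _; split => // i; rewrite -xd.
have [g gP] := choice gex.
pose C : R := 2 `^ (2 * u * M%:R + 2 * s * b * (1 - e)).
have C0 : 0 < C by exact: powR2_gt0.
have usn : 0 <= u <= s by rewrite !ltW.
have wle y n : 0 < y <= 1 -> weight w M J m y n <=
    C * (2 ^- (\sum_(i < n.+2) digit i.+1 (g y))) `^ u.
  move=> y01; have [_ gd] := gP _ y01.
  apply: le_trans (weight_le wM n usn (ltW b0) (addr_ge0 c0 ler01) y01 mle J1 Ji ueq) _.
  under [in leRHS]eq_bigr => i _ do rewrite gd.
  by rewrite powR2_exprn -[in leRHS](powR_mulrn _ (powR_ge0 _ _)) -powRrM mulNr.
apply: (@hausdorff_measure_neq0 _ t C _ g t0 (ltW C0)) => [y y01|y z y01 z01].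
  have [x01 gd] := gP _ y01.
  apply: (@limsup_set_of_digits _ _ _ (maxn M 1)%:R) => // [n|N].
    rewrite gd le_max; have [Jn|Jn] := boolP (J n).
      rewrite /word Jn /m; case: leqP => _; last by rewrite ler_nat leq_maxr.
      by have /andP[-> _] := truncn_itv (anr0 n.+1); rewrite orbT.
    by rewrite ler_nat (leq_trans (word_le _ _ _ y01 Jn))// leq_maxl.
  have [n Nn Jn] := Jinf N; exists n => //.
  rewrite gd /word Jn lerBlDr natr1.
  have /andP[_ /ltW tr] := truncn_itv (anr0 n.+1); apply: (le_trans tr).
  by rewrite ler_nat ltnS leq_maxr.
suff H y' z' : 0 < y' <= 1 -> 0 < z' <= 1 -> forall n,
    (forall i, (i < n)%N -> word w M J m y' i = word w M J m z' i) ->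
    (word w M J m y' n < word w M J m z' n)%N ->
    `|y' - z'| <= C * `|g y' - g z'| `^ t.
  (* If no letter differs, |y - z| is at most every weight, and the weights tend to 0 because all
     digits are at least 1. *)
  have [eqw|/existsNP] := pselect (forall i, word w M J m y i = word w M J m z i).
    suff -> : y = z by rewrite subrr normr0 mulr_ge0 ?powR_ge0// ltW.
    apply/eqP; rewrite -subr_eq0 -normr_le0; apply/ler_addgt0Pr => d d0; rewrite add0r.
    have : geometric C (2 `^ (- u)) n @[n --> \oo] --> 0.
      by apply: cvg_geometric; rewrite ger0_norm ?powR_ge0// powR2N_lt1.
    move=> /cvgrPdist_lt/(_ d d0)[N _ /(_ N (leqnn N))]; rewrite sub0r normrN => /ltW Cd.
    have := le_dist_word w0 wM y01 z01 (fun i (_ : (i < N)%N) => eqw i).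
    move=> /le_trans; apply; apply: (le_trans (wle y N y01)).
    apply: le_trans Cd; apply: le_trans (ler_norm _) => /=; rewrite ler_pM2l//.
    rewrite powR2_exprn ler_wiXn2l ?powR_ge0 ?(ltW (powR2N_lt1 u0))//.
    have [_ gd] := gP _ y01.
    rewrite big_ord_recr big_ord_recr/= -addnA (leq_trans _ (leq_addr _ _))//.
    rewrite -[leqLHS]card_ord -sum1_card; apply: leq_sum => i _.
    by rewrite gd; exact: word_gt0.
  move=> exd; have {}exd : exists i, word w M J m y i != word w M J m z i.
    by case: exd => i /eqP ?; exists i.
  case: (ex_minnP exd) => n neq nmin.
  have eqw i : (i < n)%N -> word w M J m y i = word w M J m z i.
    by apply: contraPeq => /nmin; rewrite leqNgt => /negP.
  move: neq; rewrite neq_ltn => /orP[yz|zy]; first exact: H yz.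
  rewrite distrC (distrC (g y)); apply: H zy => // i /eqw//.
move=> {}y01 {}z01 n eqw ltw; apply: (le_trans (le_dist_word w0 wM y01 z01 eqw)).
apply: (le_trans (wle _ _ y01)); rewrite ler_pM2l//.
have [gy01 gyd] := gP _ y01; have [gz01 gzd] := gP _ z01.
have := @digit_gap R n _ _ gy01 gz01; rewrite gyd gzd => /(_ _ ltw) gap.
have {}gap := le_trans (gap (fun i ilen => etrans (gyd i) (etrans (eqw i ilen) (esym (gzd i)))))
  (ler_norm _).
have d0 : 0 < `|g y' - g z'| by rewrite (lt_le_trans _ gap)// invr_gt0 exprn_gt0.
apply: (@le_trans _ _ (`|g y' - g z'| `^ u)).
  by apply: ge0_ler_powR; rewrite ?nnegrE// ?(ltW u0)// invr_ge0 exprn_ge0.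
(* The distance is at most 1, so lowering the exponent from [u] to [t] does not decrease the
   power. *)
apply: ger_powR => //; by rewrite d0 dist_le1.
Qed.

(** * From measures to dimension *)

Lemma hausdorff_dimE (R : realType) (A : set R) (d : R) : 0 <= d ->
  (forall t, d < t -> hausdorff_measure t A = 0%E) ->
  (forall t, 0 <= t < d -> hausdorff_measure t A <> 0%E) ->
  hausdorff_dim A = d%:E.
Proof.
move=> d0 up low; apply/eqP; rewrite eq_le; apply/andP; split.
  apply/lee_addgt0Pr => e e0; apply: ereal_inf_lbound; exists (d + e) => //.
  by split; [exact/addr_ge0/ltW|apply: up; rewrite ltrDl].
apply: le_ereal_inf_tmp => _ [t [t0 tA] <-]; rewrite lee_fin leNgt; apply/negP => td.
by apply: low tA; rewrite t0.
Qed.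

(** Eventually n^(1 - r) >= a / b; the constant [c] is the sum of the finitely many earlier
    values. *)
Lemma powR_nat_sublinear (R : realType) (r a b : R) : r < 1 -> 0 < a -> 0 < b ->
  exists2 c, 0 <= c & forall n : nat, a * n%:R `^ r <= b * n%:R + c.
Proof.
move=> r1 a0 b0; have r1' : 0 < 1 - r by rewrite subr_gt0.
have [N Nab] := powR_nat_unbounded (a / b) r1'.
have c0 n : 0 <= a * n%:R `^ r by rewrite mulr_ge0 ?powR_ge0// ltW.
exists (\sum_(n < N.+1) a * n%:R `^ r) => [|n]; first exact: sumr_ge0.
have [nN|Nn] := leqP n N.
  rewrite (bigD1 (Ordinal (nN : (n < N.+1)%N)))//= addrCA lerDl.
  by rewrite addr_ge0 ?sumr_ge0// mulr_ge0// ltW.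
apply: (@le_trans _ _ (b * n%:R)); last by rewrite lerDl sumr_ge0.
have n0 : n%:R != 0 :> R by rewrite pnatr_eq0 -lt0n (leq_trans _ Nn).
have nE : n%:R = n%:R `^ (1 - r) * n%:R `^ r :> R.
  by rewrite -powRD ?n0 ?implybT// subrK powRr1.
by rewrite [X in b * X]nE mulrA ler_wpM2r ?powR_ge0// -ler_pdivrMl// mulrC Nab// ltnW.
Qed.

Lemma powR_nat_superlinear (R : realType) (r a b : R) : 1 < r -> 0 < a ->
  exists N, forall n : nat, (N <= n)%N -> b * n%:R <= a * n%:R `^ r.
Proof.
rewrite -subr_gt0 => r1 a0; have [N Nab] := powR_nat_unbounded (b / a) r1.
exists N.+1 => n Nn; have n0 : n%:R != 0 :> R by rewrite pnatr_eq0 -lt0n (leq_trans _ Nn).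
have nE : n%:R `^ r = n%:R `^ (r - 1) * n%:R :> R.
  by rewrite -[X in _ * X](powRr1 (ler0n _ n)) -powRD ?n0 ?implybT// subrK.
by rewrite nE mulrA ler_wpM2r// -ler_pdivrMl// mulrC Nab// ltnW.
Qed.

Lemma dimension_function_unbounded (R : realType) (t : R) : 0 < t ->
  exists b, 1 < dimension_function b t.
Proof.
move=> t0; have p : 0 < 2 `^ t - 1 :> R by rewrite subr_gt0 gt1_powR2.
have l0 : 0 < ln (2 : R) by rewrite ln_gt0// ltr1n.
(* This [b] solves 2^(bt) = 2 / (2^t - 1), so the function takes the value 2. *)
exists (ln (2 / (2 `^ t - 1)) / (t * ln 2)).
rewrite /dimension_function [X in X * _]powR2E -mulrA divfK ?mulf_neq0 ?gt_eqF//.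
by rewrite lnK ?posrE ?divr_gt0// divfK ?gt_eqF// ltr1n.
Qed.

Theorem theorem1p5 (R : realType) (r alpha : R)
    (hr : 0 < r) (halpha : 0 < alpha) :
  exists s : R, unique (dimension_equation alpha) s /\
    hausdorff_dim (limsup_set r alpha) =
      (if r < 1 then 1%E else if r == 1 then s%:E else 0%E).
Proof.
have a0 := ltW halpha.
have [s [s0 sU sE]] := dimension_equation_solvable a0.
exists s; split=> //.
have half : 0 < alpha / 2 < alpha by apply/andP; split; lra.
have /andP[half0 _] := half.
have upper (a b t : R) : 0 < t -> 1 < dimension_function b t -> 0 < a < alpha ->
    (exists N, forall n : nat, (N <= n)%N -> b * n%:R <= a * n%:R `^ r) ->
    hausdorff_measure t (limsup_set r alpha) = 0%E.
  move=> t0 bt aa bN; apply: (hausdorff_measure_upper t0 bt) => x.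
  exact: digits_of_limsup_set bN.
have [r1|r1|r1] := ltgtP r 1.
(* Case r < 1. The upper bound takes b = 0, as F(0, t) = 2^t - 1 > 1 for t > 1. *)
- apply: hausdorff_dimE => // t t1.
    have t0 : 0 < t by lra.
    apply: (upper (alpha / 2) 0) => //.
      rewrite /dimension_function mul0r powRr0 mul1r ltrBrDr.
      by rewrite -[ltLHS](powRr1 (ler0n _ 2)) ltr_powR2.
    by exists 0%N => n _; rewrite mul0r mulr_ge0 ?powR_ge0// ltW.
  (* As F(0, u) = 2^u - 1 < 1, continuity yields a positive [b], and n^r is sublinear. *)
  pose u := (1 + t) / 2.
  have u1 : u < 1 by rewrite /u; lra.
  have F0u : dimension_function 0 u < 1.
    rewrite /dimension_function mul0r powRr0 mul1r ltrBlDr.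
    by rewrite -[ltRHS](powRr1 (ler0n _ 2)) ltr_powR2.
  have [b b0 bu] : exists2 b : R, 0 < b & dimension_function b u < 1.
    have /(_ _ (lt_nbhsl F0u)) := @dimension_functionC_continuous R u 0.
    move=> /nbhs_ballP[e /= e0 eF]; exists (e / 2); first by rewrite divr_gt0.
    by apply: eF; rewrite /ball/= sub0r normrN gtr0_norm; lra.
  have [c c0 cn] := powR_nat_sublinear r1 halpha b0.
  apply: (hausdorff_measure_lower hr halpha b0 bu c0 cn).
  by rewrite /u; lra.
(* Case r > 1. Every [b] is eventually allowed; the lower bound is vacuous, since 0 <= t < 0 is
   impossible. *)
- apply: hausdorff_dimE => // t t0.
  have [b bt] := dimension_function_unbounded t0.
  by apply: (upper _ _ _ t0 bt half); exact: powR_nat_superlinear.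
  by have /andP[tge tlt] := t0; have := le_lt_trans tge tlt; rewrite ltxx.
- apply: hausdorff_dimE => [|t st|t /andP[t0 ts]]; first exact: ltW.
    have t0 : 0 < t by exact: lt_trans st.
    have Ft : 1 < dimension_function alpha t.
      by rewrite -sE; apply: dimension_function_mono => //; exact: ltW.
    have [b bb bt] : exists2 b : R, 0 < b < alpha & 1 < dimension_function b t.
      have /(_ _ (lt_nbhsr Ft)) := @dimension_functionC_continuous R t alpha.
      move=> /nbhs_ballP[e /= e0 eF].
      (* The first bound keeps alpha - d in the ball, the second keeps it positive. *)
      pose d := Num.min (e / 2) (alpha / 2).
      have d0 : 0 < d by rewrite lt_min half0 divr_gt0.
      have de : d <= e / 2 by rewrite ge_min lexx.
      have da : d <= alpha / 2 by rewrite ge_min lexx orbT.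
      exists (alpha - d); first by apply/andP; split; lra.
      by apply: eF; rewrite /ball/= opprB addrC subrK gtr0_norm; lra.
    apply: (upper _ _ _ t0 bt bb); exists 0%N => n _.
    by rewrite r1 powRr1.
  (* Strictly between t and s, F(alpha, u) < F(alpha, s) = 1; then b = alpha works with c = 0. *)
  pose u := (s + t) / 2.
  have Fu : dimension_function alpha u < 1.
    by rewrite -sE; apply: dimension_function_mono; rewrite // /u; lra.
  apply: (hausdorff_measure_lower hr halpha halpha Fu (lexx 0)) => [n|].
    by rewrite r1 powRr1// addr0.
  by rewrite /u; lra.
Qed.
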